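(* Let $q$ be an odd prime power, $\delta\in\mathbb{F}_{q^2}$ and $\gamma\in\mathbb{F}_q^*$. Then the polynomial $$f(x)=(x^q-x+\delta)^{q+3}+(x^q-x+\delta)^{q+2}+\gamma(x^q+x)$$ is a permutation polynomial of $\mathbb{F}_{q^2}$ if and only if either $q\equiv0\pmod 3$ and $\mathrm{Tr}_q^{q^2}(\delta)\neq2$, or $q\equiv2\pmod 3$ and $\mathrm{Tr}_q^{q^2}(\delta)=0$.
   Context: A polynomial over a finite field $\mathbb{F}$ is a permutation polynomial of $\mathbb{F}$ if the map it induces on $\mathbb{F}$ is a bijection. For $x\in\mathbb{F}_{q^2}$, $\mathrm{Tr}_q^{q^2}(x)=x+x^q$. *)

(* Defs.v *)
From mathcomp Require Import all_boot all_order all_algebra all_field.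
Set Implicit Arguments.
Unset Strict Implicit.
Unset Printing Implicit Defensive.
Import GRing.Theory.
Local Open Scope ring_scope.

Definition odd_prime_power (q : nat) : Prop :=
  odd q /\ exists p k : nat, [/\ prime p, (0 < k)%N & q = (p ^ k)%N].

Definition permutation_polynomial (F : finFieldType) (f : {poly F}) : Prop :=
  bijective (fun x : F => f.[x]).

(* The trace from the field with q ^ 2 elements to the field with q elements;
   its values are kept in the larger field. *)
Definition Tr (q : nat) (F : finFieldType) (x : F) : F := x + x ^+ q.

(* Main.v *)
(* Choose w in F_{q^2} with w^q = - w; then w^2 = d is a nonsquare of F_q and
   every element is u + w v with u, v in F_q.  Writing delta = e + w e1, the
   element s = x^q - x + delta is e + w v' with v' = e1 - 2 v, and
   f(x) = N(s) (s^2 + s) + 2 gamma u, where N(s) = e^2 - d v'^2.  The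
   w-coordinate of f(x) is the cubic (2 e + 1) (e^2 - d v'^2) v' in v' alone,
   while u enters the other coordinate linearly, so f permutes F_{q^2} iff this
   cubic is injective on F_q.  If 3 = 0 the cubic is additive, and its kernel
   is trivial for 2 e + 1 <> 0 as d is a nonsquare.  If e = 0 it is a
   multiple of the cube map.  If 3 e <> 0, a collision v <> v' is a point of the
   conic d (v^2 + v v' + v'^2) = e^2, found by counting squares. *)
Require Import Defs.
From mathcomp Require Import all_boot all_order all_algebra all_field.
From mathcomp Require Import ring zify.
Import GRing.Theory.
Local Open Scope ring_scope.

(** * Squares and cubes in a finite field *)

Lemma card_le_of_expr_id (F : finFieldType) (n : nat) :
  (1 < n)%N -> (forall x : F, x ^+ n = x) -> (#|F| <= n)%N.
Proof.
move=> n_gt1 expn_id.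
have szP : size ('X^n - 'X : {poly F}) = n.+1.
  by rewrite size_polyDl size_polyXn // size_polyN size_polyX ltnS.
rewrite -ltnS -szP cardE; apply: max_poly_roots; last exact: enum_uniq.
  by rewrite -size_poly_gt0 szP.
by apply/allP => x _; rewrite rootE !hornerE expn_id subrr.
Qed.

(** Each fibre of squaring has at most two elements, and the fibre over 0 only one, which makes the
    inequality strict. *)
Lemma card_squares_ge (F : finFieldType) :
  (#|F| < 2 * #|[set x ^+ 2 | x : F]|)%N.
Proof.
set S := [set _ | _ : F].
have S0 : 0 \in S by apply/imsetP; exists 0; rewrite ?expr0n.
have fib (y : F) : (\sum_(x : F | x ^+ 2 == y) 1 <= 2)%N.
  rewrite sum1_card; case: (pickP [pred x : F | x ^+ 2 == y]) => [z /= /eqP zy|no].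
    apply: leq_trans (_ : #|[set z; - z]| <= 2)%N; last by rewrite cards2; case: (_ != _).
    by apply: subset_leq_card; apply/subsetP => x; rewrite !inE => xy; rewrite -eqf_sqr zy; exact: xy.
  by rewrite eq_card0.
have fib0 : (\sum_(x : F | x ^+ 2 == 0%R) 1 <= 1)%N.
  rewrite (eq_bigl (pred1 0)) ?big_pred1_eq // => x.
  by rewrite expf_eq0.
have -> : #|F| = (\sum_(y in S) \sum_(x : F | x ^+ 2 == y) 1)%N.
  rewrite -sum1_card (partition_big_imset (fun x : F => x ^+ 2)) /=.
  by apply: eq_bigl => y.
rewrite (bigD1 (0:F)) //=.
have le_rest : (\sum_(y in S | y != 0%R) \sum_(x : F | x ^+ 2 == y) 1
    <= 2 * \sum_(y in S | y != 0%R) 1)%N.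
  by rewrite big_distrr /=; apply: leq_sum => y _; apply: fib.
have cS : #|S| = (1 + \sum_(y in S | y != 0%R) 1)%N by rewrite -sum1_card (bigD1 (0:F)).
by rewrite cS mulnDr; apply: leq_ltn_trans (leq_add fib0 le_rest) _; rewrite ltn_add2r.
Qed.

(** The values of [a * x ^+ 2] and of [c - b * y ^+ 2] each fill more than half of the field, so the
    two sets meet. *)
Lemma diagonal_conic_solvable (F : finFieldType) (a b c : F) :
  a != 0 -> b != 0 -> exists x y : F, a * x ^+ 2 + b * y ^+ 2 = c.
Proof.
move=> a0 b0; set S := [set x ^+ 2 | x : F].
have card1 : #|[set a * s | s in S]| = #|S|.
  by apply: card_imset; apply: mulfI.
have card2 : #|[set c - b * s | s in S]| = #|S|.
  by apply: card_imset => s t /addrI/oppr_inj/(mulfI b0).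
have [dis|] := boolP [disjoint [set a * s | s in S] & [set c - b * s | s in S]].
  have := max_card (mem ([set a * s | s in S] :|: [set c - b * s | s in S])).
  rewrite cardsU (disjoint_setI0 dis) cards0 subn0 card1 card2 addnn -mul2n.
  by rewrite leqNgt card_squares_ge.
case/pred0Pn => z /andP[/imsetP[_ /imsetP[x _ ->] ->] /imsetP[_ /imsetP[y _ ->] e]].
by exists x, y; rewrite e subrK.
Qed.

(** If [#|F| = 3 * j + 2], then [2 * j + 1] is an inverse of 3 modulo [#|F| - 1]. *)
Lemma cube_inj (F : finFieldType) :
  #|F| = 2 %[mod 3] -> injective (fun x : F => x ^+ 3).
Proof.
move=> q2; have [j qE] : exists j, #|F| = (3 * j + 2)%N.
  by exists (#|F| %/ 3)%N; rewrite {1}(divn_eq #|F| 3) q2 mulnC.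
apply: (can_inj (g := fun y => y ^+ (2 * j + 1))) => x.
rewrite -exprM.
have -> : (3 * (2 * j + 1) = #|F| + (3 * j + 1))%N by rewrite qE; lia.
by rewrite exprD expf_card -exprS -addnS -qE expf_card.
Qed.

(** If [#|F| = 3 * m + 1], then [x ^+ m] has cube 1 for [x != 0]. Injectivity would make it 1, and
    [x ^+ m.+1 = x] would have too many roots. *)
Lemma cube_not_inj (F : finFieldType) :
  #|F| = 1 %[mod 3] -> ~ injective (fun x : F => x ^+ 3).
Proof.
move=> q1 inj.
have [m qE] : exists m, #|F| = (3 * m).+1.
  by exists (#|F| %/ 3)%N; rewrite {1}(divn_eq #|F| 3) q1 mulnC addn1.
have m_gt0 : (0 < m)%N by have := finNzRing_gt1 F; rewrite qE; lia.
have : (#|F| <= m.+1)%N; last by rewrite qE; lia.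
apply: card_le_of_expr_id => [//|x].
have [->|x0] := eqVneq x 0; first by rewrite expr0n.
rewrite exprSr (inj (x ^+ m) 1) ?mul1r //= expr1n -exprM mulnC.
by apply: (mulIf x0); rewrite -exprSr -qE expf_card mul1r.
Qed.

(** * Injectivity of the cubic *)

Definition cubic (F : finFieldType) (d e v : F) : F :=
  (2%:R * e + 1) * (e ^+ 2 - d * v ^+ 2) * v.

Lemma cubic_not_inj (F : finFieldType) (d e : F) :
  2%:R != 0 :> F -> 3%:R != 0 :> F -> d != 0 -> e != 0 ->
  ~ injective (cubic F d e).
Proof.
move=> two0 three0 d0 e0 inj.
have four0 : 4%:R != 0 :> F by rewrite (natrM _ 2 2) mulf_neq0.
(* On the conic both values equal [(2 * e + 1) * d * v * w * (v + w)], which is symmetric in [v] and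
   [w]. *)
have key (v w : F) : d * (v ^+ 2 + v * w + w ^+ 2) = e ^+ 2 -> v = w.
  by move=> h; apply: inj; rewrite /cubic -h; ring.
have [A [B AB]] := diagonal_conic_solvable F 3%:R 1 (4%:R * e ^+ 2 / d) three0 (oner_neq0 _).
have E : 3%:R * A ^+ 2 + B ^+ 2 = 4%:R * e ^+ 2 / d by rewrite -AB mul1r.
(* The substitution [(A + B) / 2], [(A - B) / 2] diagonalises the conic: [v ^ 2 + v w + w ^ 2 = (3 A
   ^ 2 + B ^ 2) / 4]. *)
have vw : (A + B) / 2%:R = (A - B) / 2%:R.
  apply: key; transitivity (d * (3%:R * A ^+ 2 + B ^+ 2) / 4%:R); first by field; rewrite four0.
  by rewrite E; field; rewrite four0.
have B0 : B = 0.
  have : 2%:R * B = (2%:R * ((A + B) / 2%:R)) - (2%:R * ((A - B) / 2%:R)) by field.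
  by rewrite vw subrr => /eqP; rewrite mulf_eq0 (negPf two0) => /eqP.
(* A double root [v] of [X^3 - a X] comes with the further root [- 2 v]. *)
have AA : A / 2%:R = - A.
  apply: key; transitivity (d * (3%:R * A ^+ 2 + B ^+ 2) / 4%:R).
    by rewrite B0; field; rewrite four0.
  by rewrite E; field; rewrite four0.
have A0 : A = 0.
  have : 3%:R * A = 2%:R * (A / 2%:R) + 2%:R * A by field.
  rewrite AA mulrN addNr => /eqP; by rewrite mulf_eq0 (negPf three0) => /eqP.
move/eqP: E; rewrite A0 B0 !expr0n /= mulr0 addr0 eq_sym.
by rewrite !mulf_eq0 invr_eq0 (negPf d0) (negPf four0) (negPf e0).
Qed.

Lemma cubic_inj_iff (F : finFieldType) (d e : F) :
  2%:R != 0 :> F -> (3%:R == 0 :> F) = (3 %| #|F|)%N ->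
  (forall x : F, x ^+ 2 != d) ->
  injective (cubic F d e) <->
  (#|F| = 0 %[mod 3] /\ e <> 1) \/ (#|F| = 2 %[mod 3] /\ e = 0).
Proof.
move=> two0 three0 d_nonsq.
have d0 : d != 0 by rewrite eq_sym; have := d_nonsq 0; rewrite expr0n.
have cubeE v : cubic F d 0 v = - d * v ^+ 3 by rewrite /cubic; ring.
split=> [inj | [[/eqP q0 e1] | [q2 ->]]].
(* Otherwise the cubic vanishes identically and 0 collides with 1. *)
- have le0 : 2%:R * e + 1 != 0.
    apply/eqP => k0; have /eqP := oner_neq0 F; apply.
    by apply: inj; rewrite /cubic k0 !mul0r.
  case q_div3: (3 %| #|F|)%N three0 => three0.
    left; split; first by rewrite (eqP q_div3).
    by move=> e1; move: le0; rewrite e1 mulr1 natr1 three0.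
  right; have [e0|e_neq0] := eqVneq e 0; last first.
    by case: (cubic_not_inj F d e) => //; rewrite three0.
  have [q1|//] : #|F| = 1 %[mod 3] \/ #|F| = 2 %[mod 3].
    by move: #|F| q_div3 => q q_div3; lia.
  case: (cube_not_inj F) => // x y xy.
  by apply: inj; rewrite e0 !cubeE /= xy.
- have three : 3%:R = 0 :> F by apply/eqP; rewrite three0.
  have two : 2%:R = - 1 :> F by apply/eqP; rewrite -subr_eq0 opprK natr1 three.
  have le0 : 2%:R * e + 1 != 0.
    by rewrite two mulN1r addrC subr_eq0 eq_sym; apply/eqP.
  move=> v w; have [//|vw] := eqVneq v w => /eqP; rewrite -subr_eq0.
  have -> : cubic F d e v - cubic F d e w = (2%:R * e + 1) * (v - w)
      * (e ^+ 2 - d * (v - w) ^+ 2 - 3%:R * (d * v * w)).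
    by rewrite /cubic; ring.
  rewrite three mul0r subr0 !mulf_eq0 (negPf le0) subr_eq0 (negPf vw) /= subr_eq0.
  (* A nonzero element [v - w] of the kernel would exhibit [d] as the square of [e / (v - w)]. *)
  move/eqP => h; have /negP[] := d_nonsq (e / (v - w)).
  have vw0 : v - w != 0 by rewrite subr_eq0.
  by rewrite expr_div_n h mulfK ?expf_neq0.
- move=> v w; rewrite !cubeE => /mulfI h.
  by apply: (cube_inj F q2); apply: h; rewrite oppr_eq0.
Qed.

(** * Coordinates on the quadratic extension *)

Lemma natr_prime_eq0 (F : finFieldType) (r : nat) :
  prime r -> (r%:R == 0 :> F) = (r %| #|F|)%N.
Proof.
move=> r_prime; have [p p_prime charp] := finPcharP F.
rewrite -(dvdn_pcharf charp) dvdn_prime2 // (card_pprimeChar charp).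
rewrite Euclid_dvdX // dvdn_prime2 // eq_sym.
case: logn (card_pprimeChar charp) => [F1|n _]; last by rewrite andbT.
by have := finNzRing_gt1 F; rewrite F1.
Qed.

(** [iota] carries the factorisation of ['X^#|K| - 'X] into the factors ['X - a] over to [L], so its
    roots in [L] all come from [K]. *)
Lemma Frobenius_fixed (K L : finFieldType) (iota : {rmorphism K -> L}) (x : L) :
  x ^+ #|K| = x -> exists a : K, x = iota a.
Proof.
move=> x_fix; have := congr1 (map_poly iota) (finField_genPoly K).
rewrite rmorphB /= map_polyXn map_polyX rmorph_prod /=.
move/(congr1 (fun p => p.[x])); rewrite !hornerE x_fix subrr horner_prod => /esym/eqP.
rewrite prodf_seq_eq0 => /hasP[a _ /=].
by rewrite rmorphB /= map_polyX map_polyC !hornerE subr_eq0 => /eqP->; exists a.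
Qed.

Lemma quadratic_coordinates (K L : finFieldType) (iota : {rmorphism K -> L}) :
  2%:R != 0 :> K -> #|L| = (#|K| ^ 2)%N ->
  (forall x y : L, (x + y) ^+ #|K| = x ^+ #|K| + y ^+ #|K|) ->
  exists w : L, exists d : K,
    [/\ w ^+ #|K| = - w, w ^+ 2 = iota d, forall a : K, a ^+ 2 != d,
        forall x : L, exists u v : K, x = iota u + w * iota v
      & forall u v u' v' : K,
          iota u + w * iota v = iota u' + w * iota v' -> u = u' /\ v = v'].
Proof.
move=> two0 cardL frobD; set q := #|K| in cardL frobD *.
have q_gt1 : (1 < q)%N := finNzRing_gt1 K.
have twoL : 2%:R != 0 :> L by rewrite -(rmorph_nat iota) fmorph_eq0.
have frobN (x : L) : (- x) ^+ q = - x ^+ q.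
  by apply/eqP; rewrite -addr_eq0 -frobD addNr expr0n gtn_eqF ?(ltnW q_gt1).
have frobK (x : L) : (x ^+ q) ^+ q = x by rewrite -exprM mulnn -cardL expf_card.
have frob_iota a : iota a ^+ q = iota a by rewrite -rmorphXn /= expf_card.
have [x0 x0q] : exists x : L, x ^+ q != x.
  apply/existsP; apply: contraT; rewrite negb_exists => /forallP all_fix.
  have : (#|L| <= q)%N.
    by apply: card_le_of_expr_id => // x; apply/eqP; have := all_fix x; rewrite negbK.
  by rewrite cardL leqNgt -{1}(expn1 q) ltn_exp2l.
pose w := x0 - x0 ^+ q.
have w0 : w != 0 by rewrite subr_eq0 eq_sym.
have wq : w ^+ q = - w by rewrite frobD frobN frobK opprB addrC.
have [d wd] : exists d, w ^+ 2 = iota d.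
  by apply: Frobenius_fixed; rewrite -exprM mulnC exprM wq sqrrN.
have w_not_iota a : w != iota a.
  apply: contra_neq twoL => wa; have ww : w = - w by rewrite -wq wa frob_iota.
  have /eqP : 2%:R * w = 0 by rewrite mulr_natl mulr2n {1}ww addNr.
  by rewrite mulf_eq0 (negPf w0) orbF => /eqP.
exists w, d; split=> //.
- move=> a; apply/eqP => ad; have /eqP : w ^+ 2 = iota a ^+ 2.
    by rewrite wd -ad rmorphXn.
  by rewrite eqf_sqr -rmorphN !(negPf (w_not_iota _)).
(* The summands [iota u] and [w * iota v] are the halves of [x + x ^+ q] and [x - x ^+ q]. *)
- move=> x; have [u xu] : exists u, (x + x ^+ q) / 2%:R = iota u.
    apply: Frobenius_fixed; rewrite exprMn frobD frobK addrC exprVn.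
    by rewrite -(rmorph_nat iota) frob_iota.
  have [v xv] : exists v, (x - x ^+ q) / (2%:R * w) = iota v.
    apply: Frobenius_fixed; rewrite exprMn frobD frobN frobK exprVn exprMn wq.
    rewrite -(rmorph_nat iota) frob_iota; field.
    by rewrite -(rmorph_nat iota) ?fmorph_eq0 ?two0 ?w0 ?oppr_eq0.
  by exists u, v; rewrite -xu -xv; field; rewrite twoL w0.
- move=> u v u' v' E.
  have E1 : w * iota (v - v') = iota (u' - u).
    transitivity (iota u + w * iota v - iota u - w * iota v'); first by ring.
    by rewrite E; ring.
  have [vv|vv] := eqVneq v v'.
    split=> //; move: E1; rewrite vv subrr rmorph0 mulr0 => /esym/eqP.
    by rewrite fmorph_eq0 subr_eq0 => /eqP.
  have /eqP[] := w_not_iota ((u' - u) / (v - v')).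
  rewrite fmorph_div -E1 mulfK //.
  by rewrite fmorph_eq0 subr_eq0.
Qed.

(* Fq and Fq2 are the fields with q and q ^ 2 elements; iota is the inclusion
   of Fq into Fq2 (field morphisms are injective). *)
Theorem theorem3p17 (q : nat) (Fq Fq2 : finFieldType)
    (iota : {rmorphism Fq -> Fq2}) (delta : Fq2) (gamma : Fq)
    (q_opp : odd_prime_power q)
    (card_Fq : #|Fq| = q) (card_Fq2 : #|Fq2| = (q ^ 2)%N)
    (gamma_neq0 : gamma <> 0) :
  permutation_polynomial
    (('X^q - 'X + delta%:P) ^+ (q + 3) + ('X^q - 'X + delta%:P) ^+ (q + 2)
     + (iota gamma)%:P * ('X^q + 'X) : {poly Fq2})
  <->
  (q = 0 %[mod 3] /\ Tr q delta <> 2%:R) \/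
  (q = 2 %[mod 3] /\ Tr q delta = 0).
Proof.
have [q_odd [p [k [p_prime k_gt0 q_eq]]]] := q_opp.
have g0 : gamma != 0 by apply/eqP.
have two0 : 2%:R != 0 :> Fq by rewrite natr_prime_eq0 // card_Fq dvdn2 q_odd.
have frobD (x y : Fq2) : (x + y) ^+ q = x ^+ q + y ^+ q.
  apply: exprDn_pchar; rewrite q_eq pnatX.
  have charp : p \in [pchar Fq2].
    by apply: (card_finPcharP (n := (k * 2)%N)) => //; rewrite card_Fq2 q_eq expnM.
  by rewrite pnatE ?charp.
have frob_iota a : iota a ^+ q = iota a by rewrite -rmorphXn /= -card_Fq expf_card.
have [||w [d [wq wd d_nonsq coord coord_inj]]] := quadratic_coordinates Fq Fq2 iota two0.
- by rewrite card_Fq.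
- by rewrite card_Fq.
rewrite card_Fq in wq.
have conj u v : (iota u + w * iota v) ^+ q = iota u - w * iota v.
  by rewrite frobD exprMn wq !frob_iota mulNr.
have [e [e1 delta_eq]] := coord delta.
have Tr_delta : Tr q delta = iota (2%:R * e).
  by rewrite /Tr delta_eq conj; ring.
have TrP (c : Fq) : Tr q delta = 2%:R * iota c <-> e = c.
  rewrite Tr_delta; split => [/eqP|->]; last by ring.
  rewrite -(rmorph_nat iota) -rmorphM (inj_eq (fmorph_inj iota)) => /eqP.
  exact: mulfI.
(* The [Fq]-coordinate of [N(s) (s ^ 2 + s)] at [s = e + w v]. *)
pose A v := (e ^+ 2 - d * v ^+ 2) * (e ^+ 2 + d * v ^+ 2 + e).
set f := (X in permutation_polynomial X).
have f_eq u v : f.[iota u + w * iota v] =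
    iota (A (e1 - 2%:R * v) + 2%:R * gamma * u) + w * iota (cubic Fq d e (e1 - 2%:R * v)).
  have sE : ('X^q - 'X + delta%:P).[iota u + w * iota v]
      = iota e + w * iota (e1 - 2%:R * v).
    by rewrite !hornerE conj delta_eq; ring.
  rewrite /f 2!hornerD hornerM !horner_exp sE hornerD hornerXn hornerX hornerC conj.
  rewrite !(exprD _ q) !conj /A /cubic.
  rewrite !(rmorphD, rmorphN, rmorphM, rmorphXn, rmorph_nat, rmorph1) /= -wd; ring.
have -> : permutation_polynomial f <-> injective (cubic Fq d e).
  split=> [/bij_inj f_inj v1 v2 c_eq | c_inj].
    pose x u v := iota u + w * iota ((e1 - v) / 2%:R).
    have sub v : e1 - 2%:R * ((e1 - v) / 2%:R) = v by field.
    (* The first coordinate is chosen so that [2 * gamma * u] compensates [A v1 - A v2]; a collision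
       of the cubic thus lifts to one of [f]. *)
    have /f_inj/coord_inj[_] : f.[x 0 v1] = f.[x ((A v1 - A v2) / (2%:R * gamma)) v2].
      rewrite !f_eq !sub c_eq; congr (iota _ + _).
      by field; rewrite two0 g0.
    have /mulIf inv2 : (2%:R : Fq)^-1 != 0 by rewrite invr_eq0.
    by move=> /inv2/addrI/oppr_inj.
  apply: injF_bij => x y.
  have [u [v ->]] := coord x; have [u' [v' ->]] := coord y.
  rewrite !f_eq => /coord_inj[Eu /c_inj/addrI/oppr_inj/(mulfI two0) vv].
  move: Eu; rewrite vv => /addrI/mulfI -> //.
  by rewrite mulf_neq0.
rewrite cubic_inj_iff // ?natr_prime_eq0 // card_Fq.
have := TrP 0; have := TrP 1; rewrite rmorph1 rmorph0 mulr1 mulr0 => -> ->.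
by [].
Qed.
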